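(* Let $F:\mathbb{R}^p\to\mathbb{R}$ be a Bottou-Curtis-Nocedal function which satisfies the noise condition (4) of the context with $C_1=0$ and some $C_2\ge0$. Let $\{\beta_k\}_{k\ge0}$ be the iterates generated by Stochastic Gradient Descent with step matrices satisfying (P1)-(P4). Let $\epsilon>0$, and let $\bar\delta$, $\{T_j\}$, $\{N_j\}$, $\{\delta_j\}$, $\{Z_{ij}\}$ be as in the context. Suppose $$\rho\in\left(0,\sqrt{\frac{1-\bar\delta}{C_2+1}}\right)$$ and $\gamma>1$. If $$N_j>\frac{\log(\gamma)}{2\left(1-\bar\delta-\rho^2/\gamma\right)^2},$$ then $$\mathbb{P}\left[\left.\frac1{N_j}\sum_{i=1}^{N_j}\mathbf{1}\left[\|\dot f(\beta_{T_j},Z_{ij})\|_2\le\epsilon\right]<\delta_j,\ \|\dot F(\beta_{T_j})\|_2\le\frac{\rho\epsilon}{\sqrt\gamma}\,\right|\,\mathcal{F}_{T_j}\right]\le\frac1\gamma .$$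
   Context: Setting. $X$ is a random variable with values in $\mathbb{R}^d$, $f:\mathbb{R}^p\times\mathbb{R}^d\to\mathbb{R}$, and $F(\theta)=\mathbb{E}[f(\theta,X)]$. The gradient $\dot F:\mathbb{R}^p\to\mathbb{R}^p$ of $F$ exists, and the gradient $\dot f(\theta,x)\in\mathbb{R}^p$ of $f$ with respect to its first argument exists. All functions of random variables are assumed measurable. $\|\cdot\|_2$ is the Euclidean norm and $\mathbf{1}[\cdot]$ the indicator of an event. (In)equalities between random variables are understood with probability one. Bottou-Curtis-Nocedal (BCN) function. $F$ is a BCN function if: (1) $F$ is bounded from below; (2) there is $C>0$ with $\|\dot F(\theta_1)-\dot F(\theta_2)\|_2\le C\|\theta_1-\theta_2\|_2$ for all $\theta_1,\theta_2\in\mathbb{R}^p$; (3) $\dot F(\theta)=\mathbb{E}[\dot f(\theta,X)]$ for all $\theta\in\mathbb{R}^p$; (4) there are $C_1,C_2\ge 0$ such that for all $\theta\in\mathbb{R}^p$, $\mathbb{E}[\|\dot f(\theta,X)-\dot F(\theta)\|_2^2]\le C_1+C_2\|\dot F(\theta)\|_2^2$. Stochastic Gradient Descent. $X_1,X_2,\dots$ are i.i.d. with the distribution of $X$; $\beta_0\in\mathbb{R}^p$ is fixed or random, independent of $(X_k)_{k\ge1}$; $\mathcal{F}_0=\sigma(\beta_0)$, $\mathcal{F}_k=\sigma(\beta_0,X_1,\dots,X_k)$; and $\beta_{k+1}=\beta_k-M_k\dot f(\beta_k,X_{k+1})$ for $k\ge0$, where $\{M_k\}_{k\ge0}$ are non-random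 real $p\times p$ matrices satisfying: (P1) each $M_k$ is symmetric positive definite; (P2) there is $S>0$ with $\sum_{k=0}^\infty\lambda_{\max}(M_k)^2<S$; (P3) $\sum_{k=0}^\infty\lambda_{\min}(M_k)=\infty$; (P4) $\lim_{k\to\infty}\lambda_{\max}(M_k)\kappa(M_k)=0$. Here $\lambda_{\max},\lambda_{\min}$ are the largest and smallest eigenvalues and $\kappa(M)=\lambda_{\max}(M)/\lambda_{\min}(M)$. Stopping criterion data. $\{T_j:j\in\mathbb{N}\}$ is a strictly increasing sequence of almost surely finite stopping times with respect to $\{\mathcal{F}_k\}$, with stopped $\sigma$-algebras $\mathcal{F}_{T_j}$. $N_j$ is an $\mathbb{N}$-valued (so $N_j\ge1$) random variable measurable with respect to $\mathcal{F}_{T_j}$. $\bar\delta\in(0,1)$, and $\delta_j$ is a $(0,\bar\delta)$-valued random variable measurable with respect to $\mathcal{F}_{T_j}$. The $Z_{ij}$ are copies of $X$, mutually independent over all $i$ and $j$ and independent of $\{\mathcal{F}_k\}$; at index $j$ the samples $Z_{1j},\dots,Z_{N_jj}$ are used. *)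

(* Defs.v *)
From HB Require Import structures.
From mathcomp Require Import all_boot all_order all_algebra.
From mathcomp Require Import all_classical all_reals all_analysis.
From mathcomp Require Import measurable_realfun.

Set Implicit Arguments.
Unset Strict Implicit.
Unset Printing Implicit Defensive.

Import Order.TTheory GRing.Theory Num.Theory.
Import numFieldNormedType.Exports.

Local Open Scope classical_set_scope.
Local Open Scope ring_scope.

(* Points of R^n are column vectors ['cV[R]_n].  The norm that MathComp-Analysis
   puts on matrices is the max norm: it is only used for the topology and for
   differentiability, which do not depend on the choice of the norm; the
   Euclidean norm is [norm2]. *)

(* The Borel sigma-algebra of ['M[R]_(m, n)]. *)
HB.instance Definition _ (R : realType) (m n : nat) :=
  @isMeasurable.Build (sigma_display (@open 'M[R]_(m, n))) 'M[R]_(m, n)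
    <<s @open 'M[R]_(m, n) >>
    (@sigma_algebra0 _ setT (@open 'M[R]_(m, n)))
    (@sigma_algebraC _ (@open 'M[R]_(m, n)))
    (@sigma_algebra_bigcup _ setT (@open 'M[R]_(m, n))).

Section euclidean.
Context {R : realType}.

Definition norm2 (n : nat) (v : 'cV[R]_n) : R :=
  Num.sqrt (\sum_(i < n) v i 0 ^+ 2).

(* The vector of partial derivatives; it is the gradient when [g] is
   differentiable at [t]. *)
Definition gradient (n : nat) (g : 'cV[R]_n -> R) (t : 'cV[R]_n) : 'cV[R]_n :=
  \col_i 'D_(delta_mx i 0) g t.

Definition sympd (n : nat) (A : 'M[R]_n) : Prop :=
  A^T = A /\ forall v : 'cV[R]_n, v != 0 -> 0 < (v^T *m A *m v) 0 0.

(* For a symmetric real matrix of positive size, the set of eigenvalues is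
   finite and nonempty, so that [sup] and [inf] are its maximum and minimum. *)
Definition lambda_max (n : nat) (A : 'M[R]_n) : R := sup [set a | eigenvalue A a].
Definition lambda_min (n : nat) (A : 'M[R]_n) : R := inf [set a | eigenvalue A a].
Definition kappa (n : nat) (A : 'M[R]_n) : R := lambda_max A / lambda_min A.

Definition step_matrices (p : nat) (M : nat -> 'M[R]_p) : Prop :=
  [/\ forall k, sympd (M k),
      exists2 S : R, 0 < S &
        (\sum_(0 <= k <oo) (lambda_max (M k) ^+ 2)%:E < S%:E)%E,
      (\sum_(0 <= k <oo) (lambda_min (M k))%:E = +oo)%E &
      (lambda_max (M k) * kappa (M k)) @[k --> \oo] --> (0 : R)].

End euclidean.

Section probability_notions.
Context {R : realType} {d : measure_display} {T : measurableType d}.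
Variable P : probability T R.

(* Sub-sigma-algebras of the ambient one are represented by the sets of their
   elements. *)
Definition measurable_wrt {d' : measure_display} {T' : measurableType d'}
    (G : set_system T) (Y : T -> T') : Prop :=
  forall B, measurable B -> G (Y @^-1` B).

Definition sigma_family {I : Type} {d' : measure_display}
    {T' : measurableType d'} (Y : I -> T -> T') : set_system T :=
  <<s \bigcup_i g_sigma_algebra_preimage (Y i) >>.

Definition independent_systems (G H : set_system T) : Prop :=
  forall A B, G A -> H B -> P (A `&` B) = (P A * P B)%E.

Definition mutually_independent {I : eqType} {d' : measure_display}
    {T' : measurableType d'} (Y : I -> T -> T') : Prop :=
  forall (s : seq I) (B : I -> set T'), uniq s ->
    (forall i, measurable (B i)) ->
    P (\bigcap_(i in [set` s]) (Y i @^-1` B i)) =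
      (\prod_(i <- s) P (Y i @^-1` B i))%E.

Definition same_distribution {d' : measure_display} {T' : measurableType d'}
    (Y Z : {RV P >-> T'}) : Prop :=
  forall B, measurable B -> distribution P Y B = distribution P Z B.

(* [Y] is a version of the conditional probability of [A] given [G]. *)
Definition is_cond_prob (G : set_system T) (A : set T) (Y : T -> R) : Prop :=
  [/\ measurable_wrt G Y, P.-integrable setT (EFin \o Y) &
      forall B, G B -> (\int[P]_(w in B) (Y w)%:E = P (A `&` B))%E].

End probability_notions.

(* Versions exist, so that a statement about all of them is not vacuous. *)
Lemma is_cond_prob_exists (R : realType) (d : measure_display)
    (T : measurableType d) (P : probability T R) (G : set_system T) (A : set T) :
  sigma_algebra setT G -> G `<=` measurable -> measurable A ->
  exists Y, is_cond_prob P G A Y.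
Proof.
move=> sG GT mA.
have GE : <<s G >> = G by exact: sigma_algebra_id.
pose S := g_sigma_algebraType G.
have mid : measurable_fun setT (idfun : T -> S).
  by move=> _ B mB; rewrite setTI; apply: GT; rewrite -GE.
pose phi : {mfun T >-> S} :=
  HB.pack (idfun : T -> S) (isMeasurableFun.Build _ _ _ _ _ mid).
pose mu := distribution P phi.
pose nu0 : {measure set S -> \bar R} := pushforward (mrestr P mA) phi.
pose nu := nu0 mid.
have finnu : fin_num_fun nu.
  move=> B mB; rewrite /nu /= /pushforward /mrestr fin_num_measure//.
  by apply: measurableI => //; apply: GT; rewrite -GE.
pose nuF := Measure_isFinite.Build _ _ _ nu finnu.
pose nu' : {finite_measure set S -> \bar R} :=
  HB.pack (Measure.sort nu) (Measure.class nu) nuF.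
pose g : S -> \bar R := Radon_Nikodym_SigmaFinite.f nu' mu.
have dom : nu' `<< mu.
  apply/null_content_dominatesP => B mB muB.
  have mB' : d.-measurable B by apply: GT; rewrite -GE.
  apply/eqP; rewrite eq_le measure_ge0 andbT -[leRHS]muB.
  rewrite /nu' /= /nu /= /pushforward /mrestr /mu /distribution /pushforward.
  by apply: le_measure; rewrite ?inE//; exact: measurableI.
have gfin := Radon_Nikodym_SigmaFinite.f_fin_num dom.
have gint := Radon_Nikodym_SigmaFinite.f_integrable dom.
have g0 := Radon_Nikodym_SigmaFinite.f_ge0 dom.
have mg := measurable_int _ gint.
rewrite -/g in mg gfin gint g0.
have gE (B : set T) : G B -> (\int[mu]_(x in B) g x = \int[P]_(x in B) g x)%E.
  move=> GB; rewrite ge0_integral_pushforward//; first by rewrite -GE in GB.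
  exact: (measurable_funS measurableT (@subsetT _ _) mg).
exists (fine \o g); split.
- move=> B mB.
  have := measurableT_comp (fine_measurable measurableT) mg.
  move=> /(_ measurableT B mB); rewrite setTI => h.
  by rewrite -GE.
- have -> : EFin \o (fine \o g) = g by apply/funext => x /=; rewrite fineK.
  apply/integrableP; split.
    have := measurableT_comp mg mid; exact.
  have /integrableP[_] := gint.
  have -> : (\int[mu]_x `|g x| = \int[mu]_x g x)%E.
    by apply: eq_integral => x _; rewrite gee0_abs.
  rewrite gE; last by case: sG => ? h _; rewrite -(setD0 [set: T]); exact: h.
  suff -> : (\int[P]_x `|g x| = \int[P]_x g x)%E by [].
  by apply: eq_integral => x _; rewrite gee0_abs.
- move=> B GB; rewrite setIC.
  under eq_integral do rewrite /= fineK//.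
  rewrite -gE// -Radon_Nikodym_SigmaFinite.f_integral//.
  by rewrite -GE in GB.
Qed.

(* Random times take values in N extended by [None], which stands for +oo. *)
Section random_times.
Context {d : measure_display} {T : measurableType d}.

Definition time_le (s : option nat) (k : nat) : bool :=
  if s is Some n then (n <= k)%N else false.

Definition time_lt (s t : option nat) : bool :=
  match s, t with
  | Some m, Some n => (m < n)%N
  | Some _, None => true
  | None, _ => false
  end.

Definition stopping_time (Fil : nat -> set_system T) (tau : T -> option nat) :
    Prop :=
  forall k, Fil k [set w | time_le (tau w) k].

Definition stopped_sigma (Fil : nat -> set_system T) (tau : T -> option nat) :
    set_system T :=
  [set A | measurable A /\
           forall k, Fil k (A `&` [set w | time_le (tau w) k])].

(* The value where [tau] is infinite is a convention: it is only used for
   almost surely finite times. *)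
Definition at_time {V : Type} (Y : nat -> T -> V) (tau : T -> option nat)
    (w : T) : V :=
  if tau w is Some k then Y k w else Y 0 w.

Lemma stopped_sigma_algebra (Fil : nat -> set_system T)
    (tau : T -> option nat) :
  (forall k, sigma_algebra setT (Fil k)) -> stopping_time Fil tau ->
  sigma_algebra setT (stopped_sigma Fil tau).
Proof.
move=> sF st; split.
- by split => // k; rewrite set0I; case: (sF k).
- move=> A [mA FA]; split; first exact: measurableD.
  move=> k; rewrite setTD.
  have -> : ~` A `&` [set w | time_le (tau w) k] =
      ~` ((A `&` [set w | time_le (tau w) k]) `|`
          ~` [set w | time_le (tau w) k]).
    by rewrite setCU setCK setCI setIUl setICl setU0.
  have [_ hC _] := sF k.
  have hC' B : Fil k B -> Fil k (~` B) by move=> /hC; rewrite setTD.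
  have hU B C : Fil k B -> Fil k C -> Fil k (B `|` C).
    move=> FB FC; rewrite -bigcup2E; have [h0 _ hb] := sF k.
    by apply: hb => -[|[|i]].
  by apply: (hC'); apply: hU; [exact: FA|apply: (hC'); exact: st].
- move=> A hA; split; first by apply: bigcup_measurable => i _; case: (hA i).
  move=> k; rewrite setI_bigcupl; have [_ _ hb] := sF k.
  by apply: hb => i; case: (hA i).
Qed.

End random_times.

Section sgd.
Context {R : realType} {d : measure_display} {T : measurableType d}.
Variable P : probability T R.
Variables p q : nat.

(* gradient of [f] with respect to its first argument *)
Definition gradient1 (f : 'cV[R]_p -> 'cV[R]_q -> R)
    (t : 'cV[R]_p) (x : 'cV[R]_q) : 'cV[R]_p :=
  gradient (f ^~ x) t.

(* An equality ['E_P[Y] = r%:E] with a finite right-hand side entails that the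
   measurable function [Y] is integrable, since the integral is the difference
   of those of the positive and negative parts, with +oo - +oo = -oo. *)
Definition is_objective (X : T -> 'cV[R]_q) (f : 'cV[R]_p -> 'cV[R]_q -> R)
    (F : 'cV[R]_p -> R) : Prop :=
  forall t, ('E_P[fun w => f t (X w)] = (F t)%:E)%E.

Definition noise_condition (X : T -> 'cV[R]_q)
    (f : 'cV[R]_p -> 'cV[R]_q -> R) (F : 'cV[R]_p -> R) (C1 C2 : R) : Prop :=
  forall t,
    ('E_P[fun w => (norm2 (gradient1 f t (X w) - gradient F t) ^+ 2)%R]
     <= (C1 + C2 * norm2 (gradient F t) ^+ 2)%:E)%E.

Definition BCN (X : T -> 'cV[R]_q) (f : 'cV[R]_p -> 'cV[R]_q -> R)
    (F : 'cV[R]_p -> R) : Prop :=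
  [/\ exists m : R, forall t, m <= F t,
      exists2 C : R, 0 < C &
        forall t1 t2,
          norm2 (gradient F t1 - gradient F t2) <= C * norm2 (t1 - t2),
      forall t i, ('E_P[fun w => (gradient1 f t (X w) i 0)%R] =
                   (gradient F t i 0)%:E)%E &
      exists C1 C2 : R, [/\ 0 <= C1, 0 <= C2 & noise_condition X f F C1 C2]].

(* The samples are numbered from 0: [X k] is used in the step from the iterate
   [k] to the iterate [k.+1]. *)
Fixpoint sgd (f : 'cV[R]_p -> 'cV[R]_q -> R) (M : nat -> 'M[R]_p)
    (beta0 : T -> 'cV[R]_p) (X : nat -> T -> 'cV[R]_q) (k : nat) (w : T) :
    'cV[R]_p :=
  if k is k'.+1 then
    sgd f M beta0 X k' w - M k' *m gradient1 f (sgd f M beta0 X k' w) (X k' w)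
  else beta0 w.

(* sigma(beta0, X_0, ..., X_(k-1)) *)
Definition sgd_filtration (beta0 : T -> 'cV[R]_p) (X : nat -> T -> 'cV[R]_q)
    (k : nat) : set_system T :=
  <<s g_sigma_algebra_preimage beta0 `|`
      \bigcup_(i in `I_k) g_sigma_algebra_preimage (X i) >>.

End sgd.

(* Main.v *)
(* Markov's inequality is applied to the frequency of the failures
   {|grad f(beta_T, Z_i)| > epsilon}: on the event E it exceeds 1 - deltabar,
   while, given F_T and on {|grad F(beta_T)| <= rho epsilon / sqrt gamma}, each
   failure has probability at most
     E|grad f|^2 / epsilon^2 <= (C2 + 1) |grad F|^2 / epsilon^2
       <= (C2 + 1) rho^2 / gamma <= (1 - deltabar) / gamma,
   whence the bound 1 / gamma.  Conditioning on F_T is made elementary by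
   cutting Omega into the countably many sets {T = k, N = n}: on such a piece
   beta_T is the F_k-measurable variable beta_k, independent of Z_i, and
   Fubini's theorem applies. *)
Require Import Defs.
From HB Require Import structures.
From mathcomp Require Import all_boot all_order all_algebra.
From mathcomp Require Import all_classical all_reals all_analysis.
From mathcomp Require Import measurable_realfun ring.

Set Implicit Arguments.
Unset Strict Implicit.
Unset Printing Implicit Defensive.

Import Order.TTheory GRing.Theory Num.Theory.
Import numFieldNormedType.Exports.

Local Open Scope classical_set_scope.
Local Open Scope ring_scope.



(** * Borel measurability of matrix-valued maps and the Euclidean norm *)

Section borel_matrices.
Context {R : realType}.

Lemma continuous_measurable_mx (m n : nat) (g : 'M[R]_(m, n) -> R) :
  continuous g -> measurable_fun setT g.
Proof.
move=> /continuousP cg; apply: (measurability _ (RGenOpens.measurableE R)).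
move=> _ [_ [a [b ->] <-]]; rewrite setTI; apply: sub_sigma_algebra.
exact/cg/interval_open.
Qed.

Lemma measurable_coord (m n : nat) i j :
  measurable_fun setT (fun A : 'M[R]_(m, n) => A i j).
Proof. by apply: continuous_measurable_mx; exact: coord_continuous. Qed.

(** Density of the rational matrices. The index set is countable, so a Borel question about open
    sets reduces to one about balls. *)
Lemma open_mx_bigcup_ratr (m n : nat) (U : set 'M[R]_(m, n)) : open U ->
  U = \bigcup_(c in [set c : 'M[rat]_(m, n) * nat |
        ball (map_mx ratr c.1 : 'M[R]_(m, n)) c.2.+1%:R^-1 `<=` U])
      ball (map_mx ratr c.1 : 'M[R]_(m, n)) c.2.+1%:R^-1.
Proof.
move=> oU; apply/seteqP; split => [y Uy|y [c cU cy]]; last exact: cU.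
have /nbhs_ballP[e /= e0 yU] := open_nbhs_nbhs (conj oU Uy).
(* With [k.+1%:R^-1 < e / 2], a ball of that radius whose rational centre is that close to [y] stays
   inside the ball of radius [e] around [y]. *)
have e20 : 0 < e / 2 by rewrite divr_gt0.
have [k] := ltr_add_invr e20.
rewrite add0r => ke; have k0 : 0 < k.+1%:R^-1 :> R by rewrite invr_gt0.
have [c cP] : {c : 'I_m -> 'I_n -> rat |
    forall i j, `|y i j - ratr (c i j)| < k.+1%:R^-1}.
  pose Q i j q := `|y i j - ratr q| < k.+1%:R^-1.
  have exq i j : exists q, Q i j q.
    have [|q /[!in_itv]/=/andP[q1 q2]] :=
        @rat_in_itvoo R (y i j - k.+1%:R^-1) (y i j + k.+1%:R^-1).
      by rewrite ltrD2l gtrN.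
    by exists q; rewrite /Q ltr_distlC q1 q2.
  by exists (fun i j => xchoose (exq i j)) => i j; exact: (xchooseP (exq i j)).
have yc : ball (map_mx ratr (\matrix_(i, j) c i j) : 'M[R]_(m, n)) k.+1%:R^-1 y.
  by split=> // i j; rewrite !mxE /ball/= distrC.
exists (\matrix_(i, j) c i j, k) => //= z cz; apply: yU.
apply: (@le_ball _ _ y (k.+1%:R^-1 + k.+1%:R^-1)).
  by rewrite [leRHS]splitr lerD// ltW.
by apply: ball_triangle cz; exact: ball_sym.
Qed.

(** An open set is a countable union of balls, and a ball of the max norm is a finite intersection
    of conditions on single entries. *)
Lemma measurable_fun_mx (d : measure_display) (T : measurableType d) (m n : nat)
    (g : T -> 'M[R]_(m, n)) :
  (forall i j, measurable_fun setT (fun x => g x i j)) -> measurable_fun setT g.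
Proof.
move=> mg; apply: (@measurability _ _ _ _ _ _ (@open 'M[R]_(m, n))) => //.
move=> _ [U oU <-]; rewrite setTI (open_mx_bigcup_ratr oU) preimage_bigcup.
rewrite bigcup_mkcond; apply: countable_bigcupT_measurable => //= c.
case: ifPn => // _; set r : R := _.+1%:R^-1.
have -> : g @^-1` (ball (map_mx ratr c.1 : 'M[R]_(m, n)) r) =
    \bigcap_(ij in [set: 'I_m * 'I_n])
      ((fun x => g x ij.1 ij.2) @^-1` ball (ratr (c.1 ij.1 ij.2) : R) r).
  apply/seteqP; split => x /= => [[_ h] [i j] _ /=|h].
    by have := h i j; rewrite mxE.
  by split; [rewrite invr_gt0|move=> i j; rewrite mxE; exact: (h (i, j))].
apply: fin_bigcap_measurable => // ij _; rewrite -[X in measurable X]setTI.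
by apply: mg => //; apply: open_measurable; exact: ball_open.
Qed.

Lemma measurable_mulmx (d : measure_display) (T : measurableType d)
    (m n k : nat) (A : 'M[R]_(m, n)) (g : T -> 'M[R]_(n, k)) :
  measurable_fun setT g -> measurable_fun setT (fun x => A *m g x).
Proof.
move=> mg; apply: measurable_fun_mx => i j.
under eq_fun do rewrite mxE.
apply: measurable_sum => l; apply: measurable_funM => //.
exact: measurableT_comp (measurable_coord _ _) mg.
Qed.

Lemma measurable_submx (d : measure_display) (T : measurableType d)
    (m n : nat) (g h : T -> 'M[R]_(m, n)) :
  measurable_fun setT g -> measurable_fun setT h ->
  measurable_fun setT (fun x => g x - h x).
Proof.
move=> mg mh; apply: measurable_fun_mx => i j.
under eq_fun do rewrite !mxE.
apply: measurable_funB.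
- exact: measurableT_comp (measurable_coord _ _) mg.
- exact: measurableT_comp (measurable_coord _ _) mh.
Qed.

Lemma measurable_norm2 (n : nat) : measurable_fun setT (@norm2 R n).
Proof.
rewrite /norm2; apply: measurableT_comp.
  by apply: continuous_measurable_fun; exact: sqrt_continuous.
apply: measurable_sum => i; apply: measurable_funX.
exact: measurable_coord.
Qed.

Lemma norm2_ge0 (n : nat) (v : 'cV[R]_n) : 0 <= norm2 v.
Proof. exact: sqrtr_ge0. Qed.

Lemma norm2_sqr (n : nat) (v : 'cV[R]_n) :
  norm2 v ^+ 2 = \sum_(i < n) v i 0 ^+ 2.
Proof. by rewrite sqr_sqrtr// sumr_ge0// => i _; exact: sqr_ge0. Qed.

Lemma coord_le_norm2 (n : nat) (v : 'cV[R]_n) i : `|v i 0| <= norm2 v.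
Proof.
rewrite -sqrtr_sqr ler_wsqrtr// (bigD1 i)//= lerDl.
by apply: sumr_ge0 => j _; exact: sqr_ge0.
Qed.

(** Comparison of the two norms: [ball] refers to the max norm, so each of the [n] squared
    coordinates is at most [e ^+ 2]. *)
Lemma norm2_le_ball (n : nat) (x v : 'cV[R]_n) e : ball x e v ->
  norm2 (x - v) <= Num.sqrt n%:R * e.
Proof.
move=> [e0 xv]; rewrite -[e in leRHS](ger0_norm (ltW e0)) -sqrtr_sqr -sqrtrM//.
rewrite ler_wsqrtr// -[n in leRHS]card_ord mulr_natl -sumr_const.
apply: ler_sum => i _; rewrite !mxE -real_normK ?num_real//.
by rewrite lerXn2r ?nnegrE// ?ltW//; exact: xv.
Qed.

(** Makes the gradient of a BCN function measurable: its Lipschitz bound, stated in the Euclidean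
    norm, gives continuity of each coordinate for the max norm topology. *)
Lemma lipschitz_measurable (m n : nat) (g : 'cV[R]_m -> 'cV[R]_n) (C : R) :
  0 < C -> (forall s t, norm2 (g s - g t) <= C * norm2 (s - t)) ->
  measurable_fun setT g.
Proof.
move=> C0 lg; apply: measurable_fun_mx => i j; rewrite ord1 {j}.
apply: continuous_measurable_mx => x.
apply/(@cvgrPdist_le _ _ _ _ (nbhs_filter x)) => e e0.
(* The summand 1 keeps [K] positive when [m] is 0. *)
set K := C * (Num.sqrt m%:R + 1).
have K0 : 0 < K by rewrite mulr_gt0// ltr_wpDl// sqrtr_ge0.
have eK0 : 0 < e / K by exact: divr_gt0.
have xK : nbhs x (ball x (e / K)) by apply/nbhs_ballP; exists (e / K).
near=> t.
have xt : ball x (e / K) t by near: t; exact: xK.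
have := coord_le_norm2 (g x - g t) i; rewrite !mxE => /le_trans; apply.
apply: (le_trans (lg _ _)).
apply: (@le_trans _ _ (C * (Num.sqrt m%:R * (e / K)))).
  by rewrite ler_pM2l//; exact: norm2_le_ball.
rewrite !mulrA ler_pdivrMr// mulrC ler_wpM2l ?ltW// /K ltr_pM2l// ltrDl.
Unshelve. all: by end_near. Qed.
End borel_matrices.



(** * Freezing an independent variable, countable partitions, and Markov's inequality for counts *)

Section freezing.
Local Open Scope ereal_scope.

(** By the independence hypothesis, the image under [(Y, Z)] of [P] restricted to [A] is a product
    measure: the image of that restriction under [Y], times the law of [Z]. Fubini then integrates
    the measures of the sections of [D], each at most [c], against a measure of total mass [P A]. *)
Lemma freezing_le (d d1 d2 : measure_display) (T : measurableType d)
    (T1 : measurableType d1) (T2 : measurableType d2) (R : realType)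
    (P : probability T R) (A : set T) (Y : T -> T1) (Z : {RV P >-> T2})
    (D : set (T1 * T2)) (c : \bar R) :
  measurable A -> measurable_fun setT Y ->
  (forall B C, measurable B -> measurable C ->
    P ((A `&` Y @^-1` B) `&` Z @^-1` C) = P (A `&` Y @^-1` B) * P (Z @^-1` C)) ->
  measurable D ->
  (forall y, P (Z @^-1` xsection D y) <= c) ->
  P (A `&` [set w | D (Y w, Z w)]) <= c * P A.
Proof.
move=> mA mY indep mD Dc.
have mYZ : measurable_fun setT (fun w => (Y w, Z w)).
  exact: measurable_fun_pair.
pose mu0 : {measure set T1 -> \bar R} := pushforward (mrestr P mA) Y.
pose mu := mu0 mY.
pose nu : probability T2 R := distribution P Z.
pose m0 : {measure set (T1 * T2)%type -> \bar R} :=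
  pushforward (mrestr P mA) (fun w => (Y w, Z w)).
pose m' := m0 mYZ.
have finmu : fin_num_fun mu.
  move=> B mB; rewrite /mu /= /pushforward /mrestr fin_num_measure//.
  by apply: measurableI => //; rewrite -[X in measurable X]setTI; exact: (mY).
pose muF : {finite_measure set T1 -> \bar R} :=
  HB.pack (Measure.sort mu) (Measure.class mu)
    (Measure_isFinite.Build _ _ _ mu finmu).
(* A measure agreeing with the product on rectangles is the product measure; on rectangles, this is
   [indep]. *)
have -> : P (A `&` [set w | D (Y w, Z w)]) = (muF \x nu) D.
  rewrite (@product_measure_unique _ _ _ _ R muF nu m')//.
    by rewrite /m' /= /pushforward /mrestr setIC.
  move=> B C mB mC.
  rewrite /m' /nu /muF /= /mu /= /pushforward /mrestr /distribution.
  rewrite /pushforward [X in _ = P X * _]setIC -indep//; congr (P _).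
  by apply/seteqP; split => [w [[]]|w [[]]] /=.
rewrite /product_measure1.
apply: (@le_trans _ _ (\int[muF]_x cst c x)).
  apply: ge0_le_integral => //.
  - exact: measurable_fun_xsection.
  - by move=> x _; exact: Dc.
by rewrite integral_cst// /muF /= /mu /= /pushforward /mrestr preimage_setT setTI.
Qed.

(** Countable additivity over the level sets of [K], numbered by [pickle]. It reduces an inequality
    between measures to one on each cell. *)
Lemma measure_partition_le (d : measure_display) (T : measurableType d)
    (R : realType) (P : {measure set T -> \bar R}) (I : countType) (K : T -> I)
    (A B : set T) (c : R) : (0 <= c)%R ->
  measurable A -> measurable B -> (forall i, measurable (K @^-1` [set i])) ->
  (forall i, P (A `&` K @^-1` [set i]) <= c%:E * P (B `&` K @^-1` [set i])) ->
  P A <= c%:E * P B.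
Proof.
move=> c0 mA mB mK AB.
pose L n := [set w | pickle (K w) = n].
(* An integer that is not the code of any label gives an empty cell; [unpickle] may still return a
   label there, hence the test [pickle i == n]. *)
have LE n : L n = if unpickle n is Some i then
    if pickle i == n then K @^-1` [set i] else set0 else set0.
  apply/seteqP; split => w; rewrite /L /=.
    by move=> <-; rewrite pickleK eqxx.
  by case: unpickle => // i; case: eqP => // <- /= ->.
have mL n : measurable (L n).
  by rewrite LE; case: unpickle => // i; case: ifP.
have tL C : trivIset setT (fun n => C `&` L n).
  by move=> i k _ _ [w [[_ <-] [_ <-]]].
have decomp C : measurable C -> P C = \sum_(n <oo) P (C `&` L n).
  move=> mC; rewrite -measure_semi_bigcup//.
  - congr (P _); rewrite -setI_bigcupr; apply/esym/setIidPl => w _.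
    by exists (pickle (K w)).
  - by move=> n; exact: measurableI.
  - by apply: bigcupT_measurable => n; exact: measurableI.
rewrite (decomp A)// (decomp B)// -nneseriesZl//.
apply: lee_nneseries => // n _; rewrite LE.
by case: unpickle => [i|]; [case: ifP => _ //|]; rewrite !setI0 !measure0 mule0.
Qed.

(** Markov's inequality for the number of the events [D i] that occur, on [A]: the right-hand side
    is the integral of this number over [A]. *)
Lemma markov_count (d : measure_display) (T : measurableType d)
    (R : realType) (P : {measure set T -> \bar R}) (A : set T) (n : nat)
    (D : 'I_n -> set T) (a : R) :
  measurable A -> (forall i, measurable (D i)) -> (0 <= a)%R ->
  measurable (A `&` [set w | (a <= \sum_(i < n) \1_(D i) w)%R]) /\
  a%:E * P (A `&` [set w | (a <= \sum_(i < n) \1_(D i) w)%R]) <=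
    \sum_(i < n) P (A `&` D i).
Proof.
move=> mA mD a0; set E := [set w | _].
have ms : measurable_fun setT (fun w => \sum_(i < n) \1_(D i) w : R)%R.
  by apply: measurable_sum => i; exact: measurable_indic.
have mE : measurable E.
  rewrite (_ : E = (fun w => \sum_(i < n) \1_(D i) w : R)%R @^-1` `[a, +oo[).
    by rewrite -[X in measurable X]setTI; apply: ms.
  by apply/seteqP; split => w /=; rewrite in_itv/= andbT.
split; first exact: measurableI.
have -> : \sum_(i < n) P (A `&` D i) =
    \int[P]_(w in A) (\sum_(i < n) \1_(D i) w)%:E.
  under eq_integral do rewrite -sumEFin.
  rewrite ge0_integral_sum//.
  - by apply: eq_bigr => i _; rewrite integral_indic// setIC.
  - by move=> i; apply/measurable_EFinP; exact: measurable_indic.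
rewrite -integral_cst; last exact: measurableI.
rewrite [leRHS]integral_mkcond [leLHS]integral_mkcond.
apply: ge0_le_integral => //.
- by move=> w _; rewrite patchE; case: ifP => // _; rewrite lee_fin.
- apply/(measurable_restrictT _ _).1; first exact: measurableI.
  exact: measurable_cst.
- apply/(measurable_restrictT _ _).1 => //.
  exact/measurable_EFinP/measurable_funTS.
- move=> w _; rewrite !patchE; case: ifPn => [/set_mem[Aw Ew]|_].
    by rewrite mem_set// lee_fin.
  by case: ifP => // _; rewrite lee_fin sumr_ge0.
Qed.

End freezing.

(** * Tail bound from the second moment *)

Section second_moment.
Context {R : realType} {d : measure_display} {T : measurableType d}.
Variable P : probability T R.

(** Since [m] is the mean of [G], the second moment of [G] is its variance plus [norm2 m ^+ 2],
    hence at most [(C + 1) * norm2 m ^+ 2]. Markov's inequality for the squared norm concludes. *)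
Lemma norm2_tail (p : nat) (G : T -> 'cV[R]_p) (m : 'cV[R]_p) (C e : R) :
  measurable_fun setT G -> 0 < e ->
  (forall i, ('E_P[fun w => (G w i 0)%R] = (m i 0)%:E)%E) ->
  ('E_P[fun w => (norm2 (G w - m) ^+ 2)%R] <= (C * norm2 m ^+ 2)%:E)%E ->
  ((e ^+ 2)%:E * P [set w | (e < norm2 (G w))%R] <=
    ((C + 1) * norm2 m ^+ 2)%:E)%E.
Proof.
move=> mG e0 EG VG.
have mcoord i : measurable_fun setT (fun w => G w i 0).
  exact: measurableT_comp (measurable_coord _ _) mG.
pose g i w : R := G w i 0.
have iG i : P.-integrable setT (EFin \o g i).
  apply/integrableP; split; first by apply/measurable_EFinP; exact: mcoord.
  rewrite (integral_fin_num_abs P)//; last exact: mcoord.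
  by have := EG i; rewrite unlock => ->.
have mh : measurable_fun setT (fun w => norm2 (G w - m) ^+ 2).
  apply: measurable_funX; apply: measurableT_comp; first exact: measurable_norm2.
  exact: measurable_submx.
rewrite unlock in VG.
have ih : P.-integrable setT (EFin \o (fun w => norm2 (G w - m) ^+ 2)).
  apply/integrableP; split; first exact/measurable_EFinP.
  under eq_integral do rewrite /= ger0_norm ?sqr_ge0//.
  exact: le_lt_trans VG (ltry _).
(* Twice the inner product of [m] and [G], the cross term of the expanded square; its expectation is
   [2 * norm2 m ^+ 2]. *)
pose l w := \sum_i 2 * m i 0 * G w i 0.
have lE w : ((l w)%:E = \sum_i (2 * m i 0)%:E * (EFin \o g i) w)%E.
  by rewrite -sumEFin.
have iT : forall i, P.-integrable setT
    (fun w => (2 * m i 0)%:E * (EFin \o g i) w)%E.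
  by move=> i; exact: integrableZl.
have il : P.-integrable setT (EFin \o l).
  rewrite (_ : EFin \o l = fun w => \sum_i (2 * m i 0)%:E * (EFin \o g i) w)%E.
    exact: integrable_sum.
  by apply/funext => w; rewrite -lE.
have intl : (\int[P]_w (l w)%:E = (2 * norm2 m ^+ 2)%:E)%E.
  under eq_integral do rewrite lE.
  rewrite integral_sum//.
  under eq_bigr => i _.
    rewrite integralZl//; have := EG i; rewrite unlock => ->; over.
  rewrite norm2_sqr mulr_sumr -sumEFin.
  by apply: eq_bigr => i _; rewrite -EFinM -mulrA -expr2.
have GE w : norm2 (G w) ^+ 2 = norm2 (G w - m) ^+ 2 + l w - norm2 m ^+ 2.
  rewrite !norm2_sqr -big_split/= -sumrB; apply: eq_bigr => i _.
  rewrite !mxE; ring.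
have intG : (\int[P]_w (norm2 (G w) ^+ 2)%:E <= ((C + 1) * norm2 m ^+ 2)%:E)%E.
  under eq_integral do rewrite GE EFinB EFinD.
  have ic := finite_measure_integrable_cst P (norm2 m ^+ 2) measurableT.
  rewrite (@integralB _ _ _ P _ measurableT
    (fun w => (norm2 (G w - m) ^+ 2)%:E + (l w)%:E)%E
    (EFin \o cst (norm2 m ^+ 2)))//; last first.
    exact: (integrableD measurableT ih il).
  rewrite (integralD measurableT ih il) intl.
  have -> : (\int[P]_x (EFin \o cst (norm2 m ^+ 2)%R) x = (norm2 m ^+ 2)%:E)%E.
    by rewrite -[RHS]mule1 -(probability_setT P) -integral_cst.
  apply: (@le_trans _ _
    ((C * norm2 m ^+ 2)%:E + (2 * norm2 m ^+ 2)%:E - (norm2 m ^+ 2)%:E)%E).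
    by rewrite leeB// leeD2r.
  by rewrite -!EFinD lee_fin le_eqVlt; apply/orP; left; apply/eqP; ring.
apply: le_trans intG.
have mE : measurable [set w | e < norm2 (G w)].
  rewrite (_ : [set w | _] = (fun w => norm2 (G w)) @^-1` `]e, +oo[).
    rewrite -[X in measurable X]setTI.
    exact: (measurableT_comp (@measurable_norm2 R p) mG).
  by apply/seteqP; split => w /=; rewrite in_itv/= andbT.
rewrite -integral_cst// [leLHS]integral_mkcond.
apply: ge0_le_integral => //.
- by move=> w _; rewrite patchE; case: ifP => // _; rewrite lee_fin sqr_ge0.
- apply/(measurable_restrictT _ _).1 => //; exact: measurable_cst.
- apply/measurable_EFinP; apply: measurable_funX.
  exact: measurableT_comp (@measurable_norm2 R p) mG.
- move=> w _; rewrite patchE; case: ifPn => [/set_mem/= ew|_].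
    by rewrite lee_fin lerXn2r ?nnegrE ?norm2_ge0 ?ltW.
  by rewrite lee_fin sqr_ge0.
Qed.
End second_moment.



(** * From bounds on events to a bound on the conditional probability *)

(** The [n] summands in Markov's bound total at most [n * a * c * P A], and the threshold [n * a]
    cancels. *)
Lemma markov_frequency (d : measure_display) (T : measurableType d)
    (R : realType) (P : {measure set T -> \bar R}) (A : set T) (n : nat)
    (D : 'I_n -> set T) (a c : R) :
  (0 < n)%N -> 0 < a -> measurable A -> (forall i, measurable (D i)) ->
  (forall i, (P (A `&` D i) <= (a * c)%:E * P A)%E) ->
  (P (A `&` [set w | (n%:R * a <= \sum_(i < n) \1_(D i) w)%R]) <= c%:E * P A)%E.
Proof.
move=> n0 a0 mA mD PD.
have na0 : 0 < n%:R * a by rewrite mulr_gt0// ltr0n.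
have [mE Pcount] := markov_count P mA mD (ltW na0).
rewrite -(@lee_pmul2l _ (n%:R * a)%:E)//; apply: (le_trans Pcount).
 apply: (@le_trans _ _ (\sum_(i < n) (a * c)%:E * P A)%E).
  exact: lee_sum.
rewrite GRing.sumr_const card_ord muleA -EFinM -mulrA EFinM -muleA.
by rewrite mule_natl.
Qed.

(** Test the hypothesis on [B], the event that [Y] exceeds [c], which lies in [G]. The integral of
    [Y - c] over [B] is then at most 0 although the integrand is positive there, so [B] is null. *)
Lemma cond_prob_le (d : measure_display) (T : measurableType d) (R : realType)
    (P : probability T R) (G : set_system T) (A : set T) (Y : T -> R) (c : R) :
  G `<=` measurable -> is_cond_prob P G A Y ->
  (forall B, G B -> (P (B `&` A) <= c%:E * P B)%E) ->
  {ae P, forall w, Y w <= c}.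
Proof.
move=> GT [mY iY intY] Ac; pose B := Y @^-1` `]c, +oo[.
have GB : G B by exact: mY.
have mB : measurable B := GT _ GB.
have iYB : P.-integrable B (EFin \o Y) by exact: integrableS iY.
have ic := finite_measure_integrable_cst P c mB.
have : (\int[P]_(w in B) `|(Y w)%:E - (EFin \o cst c) w| = 0)%E.
  apply/eqP; rewrite eq_le integral_ge0 ?andbT//.
  rewrite (eq_integral (fun w => (Y w)%:E - (EFin \o cst c) w)%E); last first.
    move=> w /set_mem; rewrite /B /= in_itv/= andbT => cY.
    by rewrite ger0_norm// subr_ge0 ltW.
  rewrite integralB// intY//.
  have -> : (\int[P]_(w in B) (EFin \o cst c) w = c%:E * P B)%E.
    by rewrite -integral_cst.
  rewrite leeBlDr ?fin_numM ?fin_num_measure//.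
  by rewrite add0e setIC; exact: Ac.
move=> /(ae_eq_integral_abs P mB) [].
  by apply: emeasurable_funB; [exact: measurable_int iYB|exact: measurable_int ic].
move=> N [mN N0 BN]; exists N; split => // w /= /negP; rewrite -ltNge => cY.
apply: BN => /= h; have /h : B w by rewrite /B /= in_itv/= cY.
by move=> /eqP; rewrite -EFinB eqe subr_eq0 => /eqP Yc; rewrite Yc ltxx in cY.
Qed.

(** Stated over an arbitrary measurable space, so that it also applies to the sample space equipped
    with a smaller sigma-algebra of the filtration. *)
Lemma sgd_step_measurable (R : realType) (d : measure_display)
    (T : measurableType d) (p q : nat) (f : 'cV[R]_p -> 'cV[R]_q -> R)
    (M : 'M[R]_p) (b : T -> 'cV[R]_p) (x : T -> 'cV[R]_q) :
  measurable_fun [set: 'cV[R]_p * 'cV[R]_q]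
    (fun u : 'cV[R]_p * 'cV[R]_q => gradient1 f u.1 u.2) ->
  measurable_fun setT b -> measurable_fun setT x ->
  measurable_fun setT (fun w => b w - M *m gradient1 f (b w) (x w)).
Proof.
move=> mg mb mx; apply: measurable_submx => //; apply: measurable_mulmx.
exact: measurableT_comp mg (measurable_fun_pair mb mx).
Qed.

(** * The filtration of the iterates, adaptedness, and stopping times *)

Section filtration.
Context {R : realType} {d : measure_display} {T : measurableType d}.
Variables (P : probability T R) (p q : nat).
Variables (beta0 : {RV P >-> 'cV[R]_p}) (Xs : nat -> {RV P >-> 'cV[R]_q}).
Let Fil := sgd_filtration beta0 Xs.

Lemma sgd_filtration_algebra k : sigma_algebra setT (Fil k).
Proof. exact: smallest_sigma_algebra. Qed.

Lemma sgd_filtration_homo k l : (k <= l)%N -> Fil k `<=` Fil l.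
Proof.
move=> kl; apply: sub_sigma_algebra2; apply: setUS => A [i /= ik iA].
by exists i => //=; exact: leq_trans ik kl.
Qed.

Lemma sgd_filtration_measurable k : Fil k `<=` measurable.
Proof.
apply: smallest_sub; first exact: sigma_algebra_measurable.
move=> A [[B mB <-]|[i _ [B mB <-]]]; rewrite setTI; exact: measurable_funPTI.
Qed.

Lemma sgd_measurable_wrt (f : 'cV[R]_p -> 'cV[R]_q -> R) (M : nat -> 'M[R]_p) k :
  measurable_fun [set: 'cV[R]_p * 'cV[R]_q]
    (fun u : 'cV[R]_p * 'cV[R]_q => gradient1 f u.1 u.2) ->
  measurable_wrt (Fil k) (sgd f M beta0 Xs k).
Proof.
move=> mg; elim: k => [B mB|k IH].
  by apply: sub_sigma_algebra; left; exists B => //; rewrite setTI.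
(* Measurability with respect to [Fil k.+1] is rephrased as ordinary measurability on the space
   carrying that sigma-algebra. *)
suff h : @measurable_fun _ _ (g_sigma_algebraType
    (g_sigma_algebra_preimage beta0 `|`
     \bigcup_(i in `I_k.+1) g_sigma_algebra_preimage (Xs i)))
    'cV[R]_p setT (sgd f M beta0 Xs k.+1).
  by move=> B mB; have := h measurableT B mB; rewrite setTI.
have mk : @measurable_fun _ _ (g_sigma_algebraType
    (g_sigma_algebra_preimage beta0 `|`
     \bigcup_(i in `I_k.+1) g_sigma_algebra_preimage (Xs i)))
    'cV[R]_p setT (sgd f M beta0 Xs k).
  move=> _ B mB; rewrite setTI.
  by apply: (sgd_filtration_homo (leqnSn k)); exact: IH.
apply: (sgd_step_measurable _ mg mk).
(* The sample used in this step is [Xs k], which generates part of [Fil k.+1] since [k] lies in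
   [I_k.+1]. *)
move=> _ B mB; rewrite setTI; apply: sub_sigma_algebra; right.
by exists k => //=; exists B => //; rewrite setTI.
Qed.

End filtration.

Lemma sigma_algebraI (T : Type) (G : set_system T) A B :
  sigma_algebra setT G -> G A -> G B -> G (A `&` B).
Proof.
move=> [G0 GC GU] GA GB.
have GC' C : G C -> G (~` C) by rewrite -setTD; exact: GC.
rewrite -[A `&` B]setCK setCI -bigcup2E; apply: (GC'); apply: GU => -[|[|i]]//=.
- exact: (GC').
- exact: (GC').
Qed.

Section stopped.
Context {d : measure_display} {T : measurableType d}.
Variables (Fil : nat -> set_system T) (tau : T -> option nat).
Hypothesis Fil_algebra : forall k, sigma_algebra setT (Fil k).
Hypothesis Fil_homo : forall k l, (k <= l)%N -> Fil k `<=` Fil l.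
Hypothesis tau_stopping : stopping_time Fil tau.

(** The time equals [k.+1] when it is at most [k.+1] but not at most [k]; for 0, being at most 0
    suffices. *)
Lemma stopped_sigma_eq A k : stopped_sigma Fil tau A ->
  Fil k (A `&` tau @^-1` [set Some k]).
Proof.
move=> [_ FA]; case: k => [|k].
  rewrite (_ : _ `&` _ = A `&` [set w | time_le (tau w) 0]); first exact: FA.
  apply/seteqP; split => w [Aw] /=; first by move=> ->.
  by case: (tau w) => // n; rewrite /= leqn0 => /eqP ->.
rewrite (_ : _ `&` _ = (A `&` [set w | time_le (tau w) k.+1]) `&`
    ~` [set w | time_le (tau w) k]).
  apply: sigma_algebraI => //.
  have [_ FC _] := Fil_algebra k.+1; rewrite -setTD; apply: FC.
  exact/(Fil_homo (leqnSn k))/tau_stopping.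
apply/seteqP; split => w /=; first by move=> [Aw ->] /=; rewrite ltnn leqnn.
move=> [[Aw]]; case: (tau w) => //= n nk /negP; rewrite -ltnNge => kn.
by split => //; congr Some; apply/eqP; rewrite eqn_leq nk.
Qed.

End stopped.



(** * Failure probability of one sampled gradient, at a fixed point and then at a random one *)

Section gradient_tail.
Context {R : realType} {d : measure_display} {T : measurableType d}.
Variables (P : probability T R) (p q : nat).
Variables (X Z : {RV P >-> 'cV[R]_q}).
Variables (f : 'cV[R]_p -> 'cV[R]_q -> R) (F : 'cV[R]_p -> R).
Hypothesis mg : measurable_fun [set: 'cV[R]_p * 'cV[R]_q]
  (fun u : 'cV[R]_p * 'cV[R]_q => gradient1 f u.1 u.2).
Hypothesis F_BCN : BCN P X f F.
Variable C2 : R.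
Hypothesis F_noise : noise_condition P X f F 0 C2.
Hypothesis C2_ge0 : 0 <= C2.
Hypothesis ZX : same_distribution Z X.

Lemma measurable_gradient : measurable_fun setT (gradient F).
Proof. by case: F_BCN => _ [C C0 lF] _ _; exact: lipschitz_measurable lF. Qed.

Lemma measurable_norm2_gt (d' : measure_display) (T' : measurableType d')
    (n : nat) (g : T' -> 'cV[R]_n) (e : R) : measurable_fun setT g ->
  measurable [set x | e < norm2 (g x)].
Proof.
move=> mg'; rewrite (_ : [set _ | _] = (fun x => norm2 (g x)) @^-1` `]e, +oo[).
  rewrite -[X in measurable X]setTI.
  exact: (measurableT_comp (@measurable_norm2 R n) mg').
by apply/seteqP; split => x /=; rewrite in_itv/= andbT.
Qed.

(** [Z] has the law of [X], for which condition (3) gives the mean and the noise condition with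
    [C1 = 0] the variance bound needed in [norm2_tail]. *)
Lemma gradient_tail t e r : 0 < e -> norm2 (gradient F t) <= r ->
  (P [set w | (e < norm2 (gradient1 f t (Z w)))%R] <=
    ((C2 + 1) * r ^+ 2 / e ^+ 2)%:E)%E.
Proof.
move=> e0 Fr; have e20 : 0 < e ^+ 2 by rewrite exprn_gt0.
have mgt : measurable_fun setT (gradient1 f t).
  exact: measurableT_comp mg (measurable_pair1 t).
have := ZX (measurable_norm2_gt e mgt).
rewrite /distribution /pushforward => ZXe.
rewrite (_ : [set w | _] = Z @^-1` [set x | e < norm2 (gradient1 f t x)])//.
rewrite ZXe.
have mgX : measurable_fun setT (fun w => gradient1 f t (X w)).
  exact: measurableT_comp mgt _.
case: F_BCN => _ _ EF _.
have := norm2_tail mgX e0 (EF t).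
move=> /(_ C2) tail.
rewrite mulrC EFinM lee_pdivlMl//; apply: (le_trans (tail _)).
  by have := F_noise t; rewrite add0r.
rewrite lee_fin ler_wpM2l ?addr_ge0// lerXn2r ?nnegrE ?norm2_ge0//.
exact: le_trans (norm2_ge0 _) Fr.
Qed.

(** The bound on the true gradient is part of the event, so the section at [t] is empty unless
    [norm2 (gradient F t) <= r]. The tail bound is thus uniform in [t], as freezing requires. *)
Lemma gradient_tail_freezing (A : set T) (b : T -> 'cV[R]_p) e r :
  0 < e -> measurable A -> measurable_fun setT b ->
  (forall B C, measurable B -> measurable C ->
    P ((A `&` b @^-1` B) `&` Z @^-1` C) =
      (P (A `&` b @^-1` B) * P (Z @^-1` C))%E) ->
  (P (A `&` [set w | (e < norm2 (gradient1 f (b w) (Z w)))%R /\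
                     (norm2 (gradient F (b w)) <= r)%R]) <=
    ((C2 + 1) * r ^+ 2 / e ^+ 2)%:E * P A)%E.
Proof.
move=> e0 mA mb indep.
apply: (freezing_le (D := [set u | e < norm2 (gradient1 f u.1 u.2) /\
  norm2 (gradient F u.1) <= r]) mA mb indep).
  rewrite (_ : [set _ | _] = [set u | e < norm2 (gradient1 f u.1 u.2)] `&`
      ~` [set u | r < norm2 (gradient F u.1)]).
    apply: measurableI; first exact: measurable_norm2_gt.
    apply: measurableC; apply: measurable_norm2_gt.
    exact: measurableT_comp measurable_gradient measurable_fst.
  apply/seteqP; split => u /= [? Fr]; split => //.
    by apply/negP; rewrite -leNgt.
  by rewrite leNgt; apply/negP.
move=> t; have [Ft|Ft] := leP (norm2 (gradient F t)) r.
  rewrite (_ : _ @^-1` _ = [set w | e < norm2 (gradient1 f t (Z w))]).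
    exact: gradient_tail.
  apply/seteqP; split => w; rewrite /xsection /= inE /=; first by case.
  by split.
rewrite (_ : _ @^-1` _ = set0) ?measure0.
  by rewrite lee_fin; apply: divr_ge0; rewrite ?sqr_ge0//; apply: mulr_ge0;
     rewrite ?sqr_ge0 ?addr_ge0.
by apply/seteqP; split => w //; rewrite /xsection /= inE /= => -[_];
  rewrite leNgt Ft.
Qed.

End gradient_tail.



(** * The conditional bound at the stopping time *)

Theorem proposition3 (R : realType) (disp : measure_display)
    (Omega : measurableType disp) (P : probability Omega R) (p d : nat)
    (X : {RV P >-> 'cV[R]_d})
    (f : 'cV[R]_p -> 'cV[R]_d -> R) (F : 'cV[R]_p -> R)
    (f_measurable : measurable_fun [set: 'cV[R]_p * 'cV[R]_d]
       (fun u : 'cV[R]_p * 'cV[R]_d => f u.1 u.2))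
    (gradf_measurable : measurable_fun [set: 'cV[R]_p * 'cV[R]_d]
       (fun u : 'cV[R]_p * 'cV[R]_d => gradient1 f u.1 u.2))
    (F_objective : is_objective P X f F)
    (F_differentiable : forall t, differentiable F t)
    (f_differentiable : forall t x, differentiable (f ^~ x) t)
    (F_BCN : BCN P X f F)
    (C2 : R) (C2_ge0 : 0 <= C2)
    (F_noise : noise_condition P X f F 0 C2)
    (beta0 : {RV P >-> 'cV[R]_p}) (Xs : nat -> {RV P >-> 'cV[R]_d})
    (Xs_independent : mutually_independent P Xs)
    (Xs_distribution : forall k, same_distribution (Xs k) X)
    (beta0_independent : independent_systems P
       (g_sigma_algebra_preimage beta0) (sigma_family Xs))
    (M : nat -> 'M[R]_p) (M_steps : step_matrices M)
    (epsilon : R) (epsilon_gt0 : 0 < epsilon)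
    (deltabar : R) (deltabar_itv : 0 < deltabar < 1)
    (T : nat -> Omega -> option nat)
    (T_increasing : {ae P, forall w, forall j, time_lt (T j w) (T j.+1 w)})
    (T_stopping : forall j, stopping_time (sgd_filtration beta0 Xs) (T j))
    (T_finite : forall j, {ae P, forall w, T j w != None})
    (N : nat -> Omega -> nat)
    (N_gt0 : forall j w, (0 < N j w)%N)
    (N_measurable : forall j,
       measurable_wrt (stopped_sigma (sgd_filtration beta0 Xs) (T j)) (N j))
    (delta : nat -> Omega -> R)
    (delta_itv : forall j w, 0 < delta j w < deltabar)
    (delta_measurable : forall j,
       measurable_wrt (stopped_sigma (sgd_filtration beta0 Xs) (T j)) (delta j))
    (Z : nat -> nat -> {RV P >-> 'cV[R]_d})
    (Z_distribution : forall i j, same_distribution (Z i j) X)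
    (Z_independent : mutually_independent P
       (fun ij : nat * nat => Z ij.1 ij.2 : Omega -> 'cV[R]_d))
    (Z_independent_filtration : forall k, independent_systems P
       (sigma_family (fun ij : nat * nat => Z ij.1 ij.2 : Omega -> 'cV[R]_d))
       (sgd_filtration beta0 Xs k))
    (rho : R) (rho_itv : 0 < rho < Num.sqrt ((1 - deltabar) / (C2 + 1)))
    (gamma : R) (gamma_gt1 : 1 < gamma) (j : nat)
    (N_large : {ae P, forall w,
       ln gamma / (2 * (1 - deltabar - rho ^+ 2 / gamma) ^+ 2) < (N j w)%:R}) :
  let beta_T := at_time (sgd f M beta0 Xs) (T j) in
  let E := [set w |
    ((N j w)%:R^-1 *
       \sum_(i < N j w)
         ((norm2 (gradient1 f (beta_T w) (Z i j w)) <= epsilon)%R : bool)%:R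
     < delta j w) /\
    norm2 (gradient F (beta_T w)) <= rho * epsilon / Num.sqrt gamma] in
  forall Y : Omega -> R,
    is_cond_prob P (stopped_sigma (sgd_filtration beta0 Xs) (T j)) E Y ->
    {ae P, forall w, Y w <= gamma^-1}.
Proof.
move=> beta_T E Y condY.
set Fil := sgd_filtration beta0 Xs in condY *.
have FilA k : sigma_algebra setT (Fil k) by exact: sgd_filtration_algebra.
have FilH : forall k l, (k <= l)%N -> Fil k `<=` Fil l.
  by move=> k l; exact: sgd_filtration_homo.
have FilM k : Fil k `<=` measurable by exact: sgd_filtration_measurable.
have SA := stopped_sigma_algebra FilA (T_stopping j).
have gamma0 : 0 < gamma by exact: lt_trans gamma_gt1.
pose b k := sgd f M beta0 Xs k.
have bF k : measurable_wrt (Fil k) (b k) by exact: sgd_measurable_wrt.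
have mb k : measurable_fun setT (b k).
  by move=> _ B mB; rewrite setTI; apply: FilM; exact: bF.
have mdelta : measurable_fun setT (delta j).
  by move=> _ B mB; rewrite setTI; case: (delta_measurable j _ mB).
have mTS k : measurable (T j @^-1` [set Some k]).
  apply: (FilM k); rewrite -[X in Fil k X]setTI.
  apply: (stopped_sigma_eq FilA FilH (T_stopping j)); split => // l.
  by rewrite setTI; exact: T_stopping.
have mT s : measurable (T j @^-1` [set s]).
  case: s => [k|]; first exact: mTS.
  rewrite (_ : _ @^-1` _ = ~` \bigcup_k T j @^-1` [set Some k]).
    by apply: measurableC; exact: bigcup_measurable.
  apply/seteqP; split => w /=; first by move=> Tw [k _ /=]; rewrite Tw.
  by case Tw: (T j w) => [k|//] nk; exfalso; apply: nk; exists k.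
have SN n : stopped_sigma Fil (T j) (N j @^-1` [set n]) by exact: N_measurable.
have mN n : measurable (N j @^-1` [set n]) by case: (SN n).
(* The label of the cell containing [w] in the countable partition by the values of the stopping
   time and of the sample size. *)
pose K w := (T j w, N j w).
have KE i : K @^-1` [set i] = T j @^-1` [set i.1] `&` N j @^-1` [set i.2].
  apply/seteqP; split => w /=; rewrite /K; first by move=> <-.
  by case: i => ? ? /= [-> ->].
have mK i : measurable (K @^-1` [set i]).
  by rewrite KE; exact: measurableI.
have PT0 : P (T j @^-1` [set None]) = 0%E.
  have [N0 [mN0 PN0 TN0]] := T_finite j.
  apply: subset_measure0 (mT None) mN0 _ PN0.
  by move=> w /= Tw; apply: TN0 => /=; rewrite Tw.
pose r := rho * epsilon / Num.sqrt gamma.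
(* The event [E] with the time and the sample size replaced by constants; only [delta j] stays
   random. *)
pose E_ k n := [set w | n%:R^-1 * (\sum_(i < n)
    ((norm2 (gradient1 f (b k w) (Z i j w)) <= epsilon)%R : bool)%:R) < delta j w] `&`
  ~` [set w | r < norm2 (gradient F (b k w))].
have gZ k i : measurable_fun setT (fun w => gradient1 f (b k w) (Z i j w)).
  exact: (measurableT_comp gradf_measurable (measurable_fun_pair (mb k) _)).
have mgF := measurable_gradient F_BCN.
have mE_ k n : measurable (E_ k n).
  apply: measurableI; last first.
    apply: measurableC; apply: measurable_norm2_gt.
    exact: measurableT_comp mgF (mb k).
  pose h w : R := n%:R^-1 * (\sum_(i < n)
    \1_(~` [set w | epsilon < norm2 (gradient1 f (b k w) (Z i j w))]) w) - delta j w.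
  rewrite (_ : [set _ | _] = h @^-1` `]-oo, 0[).
    rewrite -[X in measurable X]setTI; apply: (_ : measurable_fun setT h) => //.
    apply: measurable_funB => //; apply: measurable_funM => //.
    apply: measurable_sum => i; apply: measurable_indic; apply: measurableC.
    exact: measurable_norm2_gt.
  apply/funext => w /=.
  rewrite in_itv/= /h subr_lt0; congr (is_true (_ * _ < _)).
  apply: eq_bigr => i _; rewrite indicE in_setC leNgt; congr (_%:R); congr negb.
  by apply/idP/idP; rewrite inE.
have EE w : E w <-> E_ (odflt 0%N (T j w)) (N j w) w.
  rewrite /E /E_ /=.
  (* The default 0 in [odflt] matches the convention of [at_time] at infinite times. *)
  have -> : beta_T w = b (odflt 0%N (T j w)) w.
    by rewrite /beta_T /at_time; case: (T j w).
  split=> -[Nd Fr]; split => //; first by apply/negP; rewrite -leNgt.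
  by rewrite leNgt; apply/negP.
have EK i : E `&` K @^-1` [set i] = E_ (odflt 0%N i.1) i.2 `&` K @^-1` [set i].
  apply/seteqP; split => w [Ew Kw]; split => //;
    have iE : i = (T j w, N j w) by rewrite -Kw.
    rewrite iE; exact: (EE w).1 Ew.
  by apply: (EE w).2; rewrite iE in Ew.
have mE : measurable E.
  rewrite (_ : E = \bigcup_i (E `&` K @^-1` [set i])).
    apply: countable_bigcupT_measurable => // i.
    by rewrite EK; exact: measurableI.
  by rewrite -setI_bigcupr; apply/esym/setIidPl => w _; exists (K w).
have mS B : stopped_sigma Fil (T j) B -> measurable B by case.
(* It remains to bound the probability of [B] intersected with [E] by [gamma^-1 * P B], for [B] in
   the stopped sigma-algebra, cell by cell. *)
apply: (cond_prob_le mS condY) => B SB.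
have mB := mS _ SB.
apply: (measure_partition_le (K := K)) => //.
- by rewrite invr_ge0 ltW.
- exact: measurableI.
move=> [s n]; have [n0|n0] := posnP n.
  rewrite KE /= (_ : N j @^-1` [set n] = set0) ?setI0 ?measure0 ?mule0//.
  by apply/seteqP; split => w //= Nw; have := N_gt0 j w; rewrite Nw n0.
(* The cells of infinite time are null. *)
case: s => [k|]; last first.
  rewrite (@subset_measure0 _ _ _ P _ (T j @^-1` [set None])) //.
  - by rewrite mule_ge0// lee_fin invr_ge0 ltW.
  - by apply: measurableI => //; exact: measurableI.
  - by rewrite KE => w [_ []].
rewrite -setIA EK KE /=.
(* Fixing the time to [k] turns an event of the stopped sigma-algebra into one of [Fil k], which is
   independent of the samples. *)
pose A := B `&` N j @^-1` [set n] `&` T j @^-1` [set Some k].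
have FA : Fil k A.
  apply: (stopped_sigma_eq FilA FilH (T_stopping j)).
  exact: sigma_algebraI.
have mA := FilM _ _ FA.
have -> : B `&` (T j @^-1` [set Some k] `&` N j @^-1` [set n]) = A.
  by rewrite /A [T j @^-1` _ `&` _]setIC setIA.
pose D (i : 'I_n) := [set w | epsilon < norm2 (gradient1 f (b k w) (Z i j w)) /\
  norm2 (gradient F (b k w)) <= r].
have mD i : measurable (D i).
  rewrite (_ : D i = [set w | epsilon < norm2 (gradient1 f (b k w) (Z i j w))] `&`
      ~` [set w | r < norm2 (gradient F (b k w))]).
    apply: measurableI; first exact: measurable_norm2_gt.
    apply: measurableC; apply: measurable_norm2_gt.
    exact: measurableT_comp mgF (mb k).
  apply/seteqP; split => w /= [? Fr]; split => //.
    by apply/negP; rewrite -leNgt.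
  by rewrite leNgt; apply/negP.
have /andP[db0 db1] := deltabar_itv.
have a0 : 0 < 1 - deltabar by rewrite subr_gt0.
have n0R : 0 < n%:R :> R by rewrite ltr0n.
have [mcount _] := markov_count P mA mD (ltW (mulr_gt0 n0R a0)).
(* On [E] the frequency of successes is below [delta j], hence below [deltabar], so at least
   [n * (1 - deltabar)] samples fail. *)
apply: (@le_trans _ _ (P (A `&`
    [set w | (n%:R * (1 - deltabar) <= \sum_(i < n) \1_(D i) w)%R]))).
  apply: le_measure; rewrite ?inE//.
    by apply: measurableI => //; apply: measurableI => //; exact: measurableI.
  move=> w [Bw [[Ew /negP Fr] [Tw Nw]]]; split => //=; rewrite -leNgt in Fr.
  (* The true gradient is at most [r] at this [w], so [D i] occurs exactly when sample [i] fails. *)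
  have -> : \sum_(i < n) \1_(D i) w = n%:R - \sum_(i < n)
      ((norm2 (gradient1 f (b k w) (Z i j w)) <= epsilon)%R : bool)%:R :> R.
    rewrite -[in n%:R](card_ord n) -sumr_const -sumrB; apply: eq_bigr => i _.
    rewrite indicE; have [|] := boolP (w \in D i).
      by move=> /set_mem[eg _]; rewrite leNgt eg subr0.
    case: leP => [_ _|eg]; first by rewrite subrr.
    by move/negP; case; apply/mem_set.
  rewrite mulrBr mulr1 lerD2l lerN2 -ler_pdivrMl//.
  apply: (le_trans (ltW Ew)); apply: ltW.
  by have /andP[] := delta_itv j w.
(* Used with [a = 1 - deltabar] and [c = gamma^-1]: each [D i] must have probability at most
   [(1 - deltabar) / gamma] relative to [A]. *)
apply: markov_frequency => // i; apply: le_trans.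
  apply: (gradient_tail_freezing gradf_measurable F_BCN F_noise C2_ge0
    (Z_distribution i j)) => //.
  move=> B' C mB' mC; rewrite setIC muleC.
  apply: (Z_independent_filtration k).
    apply: sub_sigma_algebra; exists (nat_of_ord i, j) => //.
    by exists C => //; rewrite setTI.
  by apply: (sigma_algebraI (FilA k) FA); exact: bF.
rewrite lee_wpmul2r// lee_fin /r.
have /andP[rho0 rhoC] := rho_itv.
have C0 : 0 < C2 + 1 by rewrite ltr_wpDl.
(* This is the upper bound on [rho], squared. *)
have rho2 : (C2 + 1) * rho ^+ 2 <= 1 - deltabar.
  rewrite mulrC -ler_pdivlMr// -[leRHS]sqr_sqrtr.
    by rewrite lerXn2r ?nnegrE ?sqrtr_ge0 ?ltW.
  by apply: divr_ge0; exact: ltW.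
have -> : (C2 + 1) * (rho * epsilon / Num.sqrt gamma) ^+ 2 / epsilon ^+ 2 =
    (C2 + 1) * rho ^+ 2 / gamma.
  rewrite expr_div_n sqr_sqrtr ?ltW//; field.
  by rewrite !gt_eqF.
by rewrite ler_pM2r ?invr_gt0.
Qed.
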